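(* (1) If $(\beta_i)_{i<\omega}$ is a sequence of ordinals and $\beta=\sum_{i<\omega}\beta_i$, then $\prod_{i<\omega}\omega^{\beta_i}=\omega^\beta$. (2) If $(\alpha_i)_{i<\omega}$ is a sequence of ordinals which is not eventually $1$, then $\prod_{i<\omega}\alpha_i=\prod_{i<\omega}m(\alpha_i)$. (3) Suppose $(\alpha_i)_{i<\omega}$ is a sequence of nonzero ordinals which is not eventually $1$, and let $\beta=\sum_{i<\omega}d(\alpha_i)$. If there is $n<\omega$ with $\alpha_i<\omega$ for all $i\ge n$, then $\prod_{i<\omega}\alpha_i=\omega^{d(\alpha_0)+\cdots+d(\alpha_{n-1})+1}=\omega^{\beta+1}$. If the sequence is not eventually $<\omega$, then $\prod_{i<\omega}\alpha_i=\prod_{i<\omega}\omega^{d(\alpha_i)}=\omega^\beta$.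
   Context: All sums, products, exponentiations are ordinal operations; $\sum_{i<\omega}$ and $\prod_{i<\omega}$ are the classical infinite ordinal sum and product (limits of the partial sums/products). For a nonzero ordinal $\alpha$ with Cantor normal form $\omega^{\xi_k}r_k+\cdots+\omega^{\xi_0}r_0$ ($\xi_k>\dots>\xi_0$, $r_i$ positive integers), $d(\alpha)=\xi_k$ is its degree and $m(\alpha)=\omega^{\xi_k}r_k$ its leading monomial; $m(0)=0$. *)

(* Defs.v *)
From Stdlib Require Import List Sorted ClassicalEpsilon RelationClasses.
Import ListNotations.

Set Implicit Arguments.

(** Ordinals are well-founded trees modulo [oeq]: [lsub f] denotes the least
    ordinal strictly above every [f a].  Equality of ordinals is [oeq], written
    [==], not Leibniz equality. *)
Inductive ord : Type := lsub (A : Type) (f : A -> ord).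

Declare Scope ord_scope.
Delimit Scope ord_scope with ord.
Bind Scope ord_scope with ord.

Definition idx (x : ord) : Type := match x with @lsub A _ => A end.
Definition elt (x : ord) : idx x -> ord :=
  match x with @lsub A f => f end.

Fixpoint ole (x y : ord) {struct x} : Prop :=
  match x, y with
  | @lsub A f, @lsub B g => forall a : A, exists b : B, ole (f a) (g b)
  end.

Definition olt (x y : ord) : Prop := exists b : idx y, ole x (elt y b).
Definition oeq (x y : ord) : Prop := ole x y /\ ole y x.

Infix "<=" := ole : ord_scope.
Infix "<" := olt : ord_scope.
Infix "==" := oeq (at level 70, no associativity) : ord_scope.

Definition osucc (x : ord) : ord := lsub (fun _ : unit => x).

(** Least upper bound, not strict. *)
Definition osup (A : Type) (f : A -> ord) : ord :=
  lsub (fun p : {a : A & idx (f a)} => elt (f (projT1 p)) (projT2 p)).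

Fixpoint fin (n : nat) : ord :=
  match n with
  | O => lsub (fun e : Empty_set => match e with end)
  | S n => osucc (fin n)
  end.

Definition omega : ord := lsub fin.

(** [x + y] is the set of the [c < x] and of the [x + d] with [d < y]. *)
Fixpoint oadd (x y : ord) {struct y} : ord :=
  match y with
  | @lsub B g =>
      lsub (fun s : idx x + B =>
              match s with inl a => elt x a | inr b => oadd x (g b) end)
  end.

(** [x * y] is the set of the [x * d + c] with [d < y] and [c < x]. *)
Fixpoint omul (x y : ord) {struct y} : ord :=
  match y with
  | @lsub B g =>
      lsub (fun p : B * idx x => oadd (omul x (g (fst p))) (elt x (snd p)))
  end.

(** [x ^ y] is the supremum of the [x ^ d * x] with [d < y] when [y] is nonzero,
    and 1 when [y] is zero: [B -> False] is inhabited exactly in that case. *)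
Fixpoint opow (x y : ord) {struct y} : ord :=
  match y with
  | @lsub B g =>
      osup (fun s : B + (B -> False) =>
              match s with inl b => omul (opow x (g b)) x | inr _ => fin 1 end)
  end.

Infix "+" := oadd : ord_scope.
Infix "*" := omul : ord_scope.
Infix "^" := opow : ord_scope.

Open Scope ord_scope.

Definition eventually (P : nat -> Prop) : Prop :=
  exists N : nat, forall n : nat, (N <= n)%nat -> P n.

(** Convergence in the order topology.  A supremum would not do for products:
    their partial products may drop to 0. *)
Definition is_lim (s : nat -> ord) (l : ord) : Prop :=
  (forall a, a < l -> eventually (fun n => a < s n)) /\
  (forall b, l < b -> eventually (fun n => s n < b)).

Definition olim (s : nat -> ord) : ord :=
  epsilon (inhabits (fin 0)) (is_lim s).

Fixpoint psum (a : nat -> ord) (n : nat) : ord :=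
  match n with O => fin 0 | S n => psum a n + a n end.

Fixpoint pprod (a : nat -> ord) (n : nat) : ord :=
  match n with O => fin 1 | S n => pprod a n * a n end.

Definition osum (a : nat -> ord) : ord := olim (psum a).
Definition oprod (a : nat -> ord) : ord := olim (pprod a).

Fixpoint cnf_val (l : list (ord * nat)) : ord :=
  match l with
  | [] => fin 0
  | (xi, r) :: l => omega ^ xi * fin r + cnf_val l
  end.

(** Exponents are listed in decreasing order; the form of 0 is the empty list. *)
Definition is_cnf (x : ord) (l : list (ord * nat)) : Prop :=
  StronglySorted (fun p q => fst q < fst p) l /\
  Forall (fun p => (0 < snd p)%nat) l /\
  x == cnf_val l.

Definition cnf (x : ord) : list (ord * nat) :=
  epsilon (inhabits []) (is_cnf x).

(** The degree of 0 is set to 0. *)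
Definition degree (x : ord) : ord :=
  match cnf x with [] => fin 0 | (xi, _) :: _ => xi end.

Definition lead_monomial (x : ord) : ord :=
  match cnf x with [] => fin 0 | (xi, r) :: _ => omega ^ xi * fin r end.

(* Main.v *)
(** Write a nonzero [x] as [omega ^ xi * r + rho] with [r > 0] and
    [rho < omega ^ xi].  Under multiplication the degrees [xi] add up, and the
    leading monomial of a product is the product of the leading monomials.  Hence
    the partial products [P n] of the [a i] and [M n] of their leading monomials
    satisfy [M n = omega ^ (d 0 + ... + d (n - 1)) * t <= P n < M n * 2].  The next
    factor [a i] different from 1 has leading monomial at least 2, which absorbs
    the factor 2; the next infinite [a i] has degree at least 1, which absorbs
    the factor [t]. *)

Require Import Defs.
From Stdlib Require Import PeanoNat Lia List Sorted Classical ClassicalEpsilon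
  Setoid Morphisms.
Import ListNotations.

(** * The order: well-foundedness and linearity *)

Lemma ole_lt_elt (x y : ord) : x <= y <-> forall a, elt x a < y.
Proof. destruct x as [A f], y as [B g]; reflexivity. Qed.

Lemma ole_refl (x : ord) : x <= x.
Proof. induction x as [A f IH]; intros a; exists a; apply IH. Qed.

Lemma ole_trans (x y z : ord) : x <= y -> y <= z -> x <= z.
Proof.
  revert y z; induction x as [A f IH]; intros [B g] [C h] Hxy Hyz a.
  destruct (Hxy a) as [b Hb], (Hyz b) as [c Hc].
  exists c; exact (IH a _ _ Hb Hc).
Qed.

#[export] Instance ole_preorder : PreOrder ole.
Proof. split; [exact ole_refl | exact ole_trans]. Qed.

#[export] Instance oeq_equivalence : Equivalence oeq.
Proof.
  split.
  - intros x; split; reflexivity.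
  - intros x y [H1 H2]; split; assumption.
  - intros x y z [H1 H2] [H3 H4]; split; etransitivity; eassumption.
Qed.

#[export] Instance ole_partial_order : PartialOrder oeq ole.
Proof. intros x y; split; intros H; exact H. Qed.

Lemma olt_le_trans (x y z : ord) : x < y -> y <= z -> x < z.
Proof.
  intros [b Hb] Hyz; destruct (proj1 (ole_lt_elt y z) Hyz b) as [c Hc].
  exists c; etransitivity; eassumption.
Qed.

Lemma ole_lt_trans (x y z : ord) : x <= y -> y < z -> x < z.
Proof. intros Hxy [b Hb]; exists b; etransitivity; eassumption. Qed.

Lemma elt_lt (x : ord) (a : idx x) : elt x a < x.
Proof. exists a; reflexivity. Qed.

Lemma olt_le (x y : ord) : x < y -> x <= y.
Proof.
  intros H; revert y H; induction x as [A f IH]; intros y [b Hb].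
  apply ole_lt_elt; intros a; exists b; simpl.
  apply IH; refine (olt_le_trans _ _ _ _ Hb); exact (elt_lt (lsub f) a).
Qed.

#[export] Instance olt_proper : Proper (oeq ==> oeq ==> iff) olt.
Proof.
  intros x x' [H1 H2] y y' [H3 H4]; split; intros H.
  - exact (ole_lt_trans _ _ _ H2 (olt_le_trans _ _ _ H H3)).
  - exact (ole_lt_trans _ _ _ H1 (olt_le_trans _ _ _ H H4)).
Qed.

(** Allows setoid rewriting along [<=] inside a strict inequality, contravariantly on the left and
    covariantly on the right. *)
#[export] Instance olt_mono : Proper (ole --> ole ==> Basics.impl) olt.
Proof.
  intros x x' Hx y y' Hy H; exact (ole_lt_trans _ _ _ Hx (olt_le_trans _ _ _ H Hy)).
Qed.

#[export] Instance olt_transitive : Transitive olt.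
Proof. intros x y z Hxy Hyz; exact (ole_lt_trans _ _ _ (olt_le _ _ Hxy) Hyz). Qed.

(** The claim is strengthened to all [y <= x] before the induction on the tree [x]: from [z < y] and
    [y <= x] one only learns that [z] is at most some child of [x], not that it is one. *)
Lemma olt_wf : well_founded olt.
Proof.
  enough (H : forall x y, y <= x -> Acc olt y) by (intros x; exact (H x x (ole_refl x))).
  induction x as [A f IH]; intros y Hy; constructor; intros z Hz.
  destruct (olt_le_trans _ _ _ Hz Hy) as [a Ha]; exact (IH a z Ha).
Qed.

Lemma olt_irrefl (x : ord) : ~ x < x.
Proof.
  induction x as [x IH] using (well_founded_ind olt_wf); intros H; exact (IH x H H).
Qed.

Lemma ole_not_lt (x y : ord) : x <= y -> ~ y < x.
Proof. intros H H'; exact (olt_irrefl _ (ole_lt_trans _ _ _ H H')). Qed.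

(** Linearity, proved classically. If no child of [x] is at least [y], then each child [f a] is
    below [y]: otherwise the induction hypothesis puts every child of [y] below [f a], that is,
    [y <= f a]. *)
Lemma not_le_lt (x y : ord) : ~ x <= y -> y < x.
Proof.
  revert y; induction x as [A f IH]; intros y H.
  destruct (classic (exists a, y <= f a)) as [[a Ha] | Hn]; [exists a; exact Ha |].
  exfalso; apply H, ole_lt_elt; intros a; simpl.
  apply NNPP; intros Hna; apply Hn; exists a.
  apply ole_lt_elt; intros b; apply IH; intros Hle; apply Hna; exists b; exact Hle.
Qed.

Lemma ole_or_lt (x y : ord) : x <= y \/ y < x.
Proof. destruct (classic (x <= y)); auto using not_le_lt. Qed.

Lemma ole_iff_lt (x y : ord) : x <= y <-> forall z, z < x -> z < y.
Proof.
  split; intros H.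
  - intros z Hz; exact (olt_le_trans _ _ _ Hz H).
  - apply ole_lt_elt; intros a; apply H, elt_lt.
Qed.

Lemma least_ord (P : ord -> Prop) :
  (exists x, P x) -> exists x, P x /\ forall y, P y -> x <= y.
Proof.
  intros [x Hx]; induction x as [x IH] using (well_founded_ind olt_wf).
  destruct (classic (exists y, y < x /\ P y)) as [[y [Hy HP]] | Hn]; [eauto |].
  exists x; split; [exact Hx |]; intros y HP.
  destruct (ole_or_lt x y) as [H | H]; [exact H | exfalso; eauto].
Qed.

Lemma ole_0 (x : ord) : fin 0 <= x.
Proof. apply ole_lt_elt; intros []. Qed.

Lemma olt_osucc (x y : ord) : x < osucc y <-> x <= y.
Proof. split; [intros [[] H]; exact H | intros H; exists tt; exact H]. Qed.

Lemma osucc_le (x y : ord) : osucc x <= y <-> x < y.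
Proof. rewrite ole_lt_elt; split; [intros H; exact (H tt) | intros H []; exact H]. Qed.

Lemma olt_fin_1 (x : ord) : x < fin 1 <-> x == fin 0.
Proof.
  rewrite (olt_osucc x (fin 0) : x < fin 1 <-> x <= fin 0).
  split; [intros H; split; [exact H | apply ole_0] | intros []; assumption].
Qed.

Lemma nonzero_ge_1 (x : ord) : ~ x == fin 0 <-> fin 1 <= x.
Proof.
  rewrite <- olt_fin_1; split; intros H.
  - destruct (ole_or_lt (fin 1) x); tauto.
  - exact (ole_not_lt _ _ H).
Qed.

Lemma osup_le (A : Type) (f : A -> ord) (y : ord) :
  osup f <= y <-> forall a, f a <= y.
Proof.
  rewrite ole_lt_elt; split.
  - intros H a; apply ole_lt_elt; intros c; exact (H (existT _ a c)).
  - intros H [a c]; exact (proj1 (ole_lt_elt _ _) (H a) c).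
Qed.

Lemma osup_ub (A : Type) (f : A -> ord) (a : A) : f a <= osup f.
Proof. apply osup_le; reflexivity. Qed.

Lemma olt_osup (A : Type) (f : A -> ord) (x : ord) :
  x < osup f <-> exists a, x < f a.
Proof.
  split.
  - intros [[a c] H]; exists a, c; exact H.
  - intros [a H]; exact (olt_le_trans _ _ _ H (osup_ub A f a)).
Qed.

(** * Arithmetic *)

Lemma olt_oadd_elt (x y z : ord) :
  z < x + y <-> z < x \/ exists b, z <= x + elt y b.
Proof.
  destruct y as [B g]; split.
  - intros [[a | b] H]; [left; exists a; exact H | right; exists b; exact H].
  - intros [[a H] | [b H]]; [exists (inl a); exact H | exists (inr b); exact H].
Qed.

Lemma ole_oadd_l (x y : ord) : x <= x + y.
Proof. apply ole_iff_lt; intros z H; apply olt_oadd_elt; left; exact H. Qed.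

#[export] Instance oadd_mono : Proper (ole ==> ole ==> ole) oadd.
Proof.
  intros x x' Hx y; induction y as [B g IH]; intros y' Hy.
  apply ole_iff_lt; intros z [H | [b H]]%olt_oadd_elt.
  - exact (olt_le_trans _ _ _ H (transitivity Hx (ole_oadd_l x' y'))).
  - destruct (proj1 (ole_lt_elt _ _) Hy b) as [b' Hb'].
    apply olt_oadd_elt; right; exists b'.
    transitivity (x + g b); [exact H | apply IH, Hb'].
Qed.

#[export] Instance oadd_proper : Proper (oeq ==> oeq ==> oeq) oadd.
Proof. intros x x' [H1 H2] y y' [H3 H4]; split; apply oadd_mono; assumption. Qed.

(** Frees the recursion from the tree representation: any [d < y] may stand for a child of [y].
    Together with the dual criterion [oadd_le] it supports proofs by induction along [<];
    multiplication and powers follow the same pattern. *)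
Lemma olt_oadd (x y z : ord) :
  z < x + y <-> z < x \/ exists d, d < y /\ z <= x + d.
Proof.
  rewrite olt_oadd_elt; split; (intros [H | H]; [left; exact H | right]).
  - destruct H as [b H]; exists (elt y b); split; [apply elt_lt | exact H].
  - destruct H as [d [[b Hb] H]]; exists b; rewrite <- Hb; exact H.
Qed.

Lemma oadd_lt_r (x y z : ord) : y < z -> x + y < x + z.
Proof. intros H; apply olt_oadd; right; exists y; split; [exact H | reflexivity]. Qed.

Lemma oadd_le_cancel_l (x y z : ord) : x + y <= x + z -> y <= z.
Proof.
  intros H; destruct (ole_or_lt y z) as [Hyz | Hzy]; [exact Hyz |].
  destruct (ole_not_lt _ _ H (oadd_lt_r _ _ _ Hzy)).
Qed.

Lemma oadd_le (x y z : ord) :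
  x + y <= z <-> x <= z /\ forall d, d < y -> x + d < z.
Proof.
  split.
  - intros H; rewrite <- H; split; [apply ole_oadd_l |].
    intros d Hd; exact (olt_le_trans _ _ _ (oadd_lt_r _ _ _ Hd) H).
  - intros [H1 H2]; apply ole_iff_lt; intros w [H | [d [Hd H]]]%olt_oadd.
    + exact (olt_le_trans _ _ _ H H1).
    + exact (ole_lt_trans _ _ _ H (H2 d Hd)).
Qed.

Lemma oadd_0_r (x : ord) : x + fin 0 == x.
Proof.
  split; [| apply ole_oadd_l].
  apply oadd_le; split; [reflexivity | intros d [[] _]].
Qed.

Lemma oadd_1_r (x : ord) : x + fin 1 == osucc x.
Proof.
  split.
  - apply oadd_le; split; [apply olt_le, olt_osucc; reflexivity |].
    intros d Hd%olt_fin_1; rewrite Hd, oadd_0_r; apply olt_osucc; reflexivity.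
  - apply osucc_le; rewrite <- (oadd_0_r x) at 1; apply oadd_lt_r, olt_fin_1; reflexivity.
Qed.

Lemma oadd_assoc (x y z : ord) : (x + y) + z == x + (y + z).
Proof.
  induction z as [z IH] using (well_founded_ind olt_wf); split.
  - apply oadd_le; split; [rewrite <- (ole_oadd_l y z); reflexivity |].
    intros d Hd; rewrite (IH d Hd); apply oadd_lt_r, oadd_lt_r, Hd.
  - apply oadd_le; split; [rewrite <- 2!ole_oadd_l; reflexivity |].
    intros d [Hd | [e [He Hd]]]%olt_oadd.
    + exact (olt_le_trans _ _ _ (oadd_lt_r _ _ _ Hd) (ole_oadd_l _ _)).
    + rewrite Hd, <- (IH e He); apply oadd_lt_r, He.
Qed.

Lemma oadd_0_l (x : ord) : fin 0 + x == x.
Proof.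
  induction x as [x IH] using (well_founded_ind olt_wf); split.
  - apply oadd_le; split; [apply ole_0 |].
    intros d Hd; rewrite (IH d Hd); exact Hd.
  - apply ole_iff_lt; intros z Hz; rewrite <- (IH z Hz); apply oadd_lt_r, Hz.
Qed.

Lemma ole_oadd_r (x y : ord) : y <= x + y.
Proof. rewrite <- (oadd_0_l y) at 1; rewrite (ole_0 x); reflexivity. Qed.

(** Left subtraction. For the least [d] with [y <= x + d], every [e < d] has [x + e < y], and this
    gives [x + d <= y]. *)
Lemma ole_subtract (x y : ord) : x <= y -> exists d, x + d == y.
Proof.
  intros H; destruct (least_ord (fun d => y <= x + d)) as [d [Hd Hmin]].
  { exists y; apply ole_oadd_r. }
  exists d; split; [| exact Hd].
  apply oadd_le; split; [exact H |].
  intros e He; apply not_le_lt; intros Hy; exact (ole_not_lt _ _ (Hmin e Hy) He).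
Qed.

Lemma fin_S (n : nat) : fin (S n) == fin n + fin 1.
Proof. symmetry; apply oadd_1_r. Qed.

Lemma fin_add (m n : nat) : fin m + fin n == fin (m + n)%nat.
Proof.
  induction n as [| n IH].
  - rewrite Nat.add_0_r; apply oadd_0_r.
  - rewrite Nat.add_succ_r, (fin_S n), <- oadd_assoc, IH, <- fin_S; reflexivity.
Qed.

Lemma fin_le (m n : nat) : (m <= n)%nat -> fin m <= fin n.
Proof.
  intros H; rewrite <- (Nat.sub_add m n H), Nat.add_comm, <- fin_add.
  apply ole_oadd_l.
Qed.

Lemma fin_lt_omega (n : nat) : fin n < omega.
Proof. exists n; reflexivity. Qed.

Lemma olt_omega (x : ord) : x < omega <-> exists n, x == fin n.
Proof.
  split; [| intros [n ->]; apply fin_lt_omega].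
  intros [n H]; change (x <= fin n) in H; induction n as [| n IH].
  - exists 0%nat; split; [exact H | apply ole_0].
  - destruct (ole_or_lt (fin (S n)) x) as [Hx | Hx].
    + exists (S n); split; assumption.
    + apply IH, olt_osucc, Hx.
Qed.

Lemma fin_add_omega (n : nat) : fin n + omega == omega.
Proof.
  split; [| apply ole_oadd_r].
  apply oadd_le; split; [apply olt_le, fin_lt_omega |].
  intros d [m ->]%olt_omega; rewrite fin_add; apply fin_lt_omega.
Qed.

Lemma olt_omul_elt (x y z : ord) :
  z < x * y <-> exists b c, z <= x * elt y b + elt x c.
Proof.
  destruct y as [B g]; split.
  - intros [[b c] H]; exists b, c; exact H.
  - intros [b [c H]]; exists (b, c); exact H.
Qed.

#[export] Instance omul_mono : Proper (ole ==> ole ==> ole) omul.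
Proof.
  intros x x' Hx y; induction y as [B g IH]; intros y' Hy.
  apply ole_iff_lt; intros z [b [c H]]%olt_omul_elt.
  destruct (proj1 (ole_lt_elt _ _) Hy b) as [b' Hb'].
  destruct (proj1 (ole_lt_elt _ _) Hx c) as [c' Hc'].
  apply olt_omul_elt; exists b', c'.
  rewrite H; apply oadd_mono; [apply IH, Hb' | exact Hc'].
Qed.

#[export] Instance omul_proper : Proper (oeq ==> oeq ==> oeq) omul.
Proof. intros x x' [H1 H2] y y' [H3 H4]; split; apply omul_mono; assumption. Qed.

Lemma olt_omul (x y z : ord) :
  z < x * y <-> exists d c, d < y /\ c < x /\ z <= x * d + c.
Proof.
  rewrite olt_omul_elt; split.
  - intros [b [c H]]; exists (elt y b), (elt x c).
    split; [apply elt_lt | split; [apply elt_lt | exact H]].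
  - intros [d [c [[b Hb] [[c' Hc] H]]]]; exists b, c'; rewrite <- Hb, <- Hc; exact H.
Qed.

Lemma omul_add_lt (x y d c : ord) : d < y -> c < x -> x * d + c < x * y.
Proof.
  intros Hd Hc; apply olt_omul; exists d, c.
  split; [exact Hd | split; [exact Hc | reflexivity]].
Qed.

Lemma omul_le (x y z : ord) :
  x * y <= z <-> forall d c, d < y -> c < x -> x * d + c < z.
Proof.
  split.
  - intros H d c Hd Hc; exact (olt_le_trans _ _ _ (omul_add_lt _ _ _ _ Hd Hc) H).
  - intros H; apply ole_iff_lt; intros w [d [c [Hd [Hc Hw]]]]%olt_omul.
    exact (ole_lt_trans _ _ _ Hw (H d c Hd Hc)).
Qed.

Lemma omul_lt_r (x y z : ord) : fin 1 <= x -> y < z -> x * y < x * z.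
Proof.
  intros Hx%osucc_le Hy; apply (ole_lt_trans _ (x * y + fin 0)); [apply ole_oadd_l |].
  apply omul_add_lt; assumption.
Qed.

Lemma omul_0_r (x : ord) : x * fin 0 == fin 0.
Proof. split; [| apply ole_0]; apply omul_le; intros d c [[] _]. Qed.

Lemma omul_0_l (x : ord) : fin 0 * x == fin 0.
Proof. split; [| apply ole_0]; apply omul_le; intros d c _ [[] _]. Qed.

Lemma omul_1_r (x : ord) : x * fin 1 == x.
Proof.
  split.
  - apply omul_le; intros d c Hd%olt_fin_1 Hc; rewrite Hd, omul_0_r, oadd_0_l; exact Hc.
  - apply ole_iff_lt; intros z Hz; apply olt_omul; exists (fin 0), z.
    split; [apply olt_fin_1; reflexivity | split; [exact Hz | apply ole_oadd_r]].
Qed.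

Lemma omul_add_r (x y z : ord) : x * (y + z) == x * y + x * z.
Proof.
  induction z as [z IH] using (well_founded_ind olt_wf); split.
  - apply omul_le; intros d c [Hd | [e [He Hd]]]%olt_oadd Hc.
    + exact (olt_le_trans _ _ _ (omul_add_lt _ _ _ _ Hd Hc) (ole_oadd_l _ _)).
    + rewrite Hd, (IH e He), oadd_assoc; apply oadd_lt_r, omul_add_lt; assumption.
  - apply oadd_le; split; [rewrite <- (ole_oadd_l y z); reflexivity |].
    intros d [e [c [He [Hc Hd]]]]%olt_omul.
    rewrite Hd, <- oadd_assoc, <- (IH e He); apply omul_add_lt; [| exact Hc].
    apply oadd_lt_r, He.
Qed.

Lemma omul_1_l (x : ord) : fin 1 * x == x.
Proof.
  induction x as [x IH] using (well_founded_ind olt_wf); split.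
  - apply omul_le; intros d c Hd Hc%olt_fin_1; rewrite (IH d Hd), Hc, oadd_0_r; exact Hd.
  - apply ole_iff_lt; intros z Hz; rewrite <- (IH z Hz).
    apply omul_lt_r; [reflexivity | exact Hz].
Qed.

Lemma omul_assoc (x y z : ord) : (x * y) * z == x * (y * z).
Proof.
  induction z as [z IH] using (well_founded_ind olt_wf); split.
  - apply omul_le; intros d c Hd [e [f [He [Hf Hc]]]]%olt_omul.
    rewrite Hc, (IH d Hd), <- oadd_assoc, <- omul_add_r.
    apply omul_add_lt; [apply omul_add_lt |]; assumption.
  - apply omul_le; intros d c [e [f [He [Hf Hd]]]]%olt_omul Hc.
    rewrite Hd, omul_add_r, <- (IH e He), oadd_assoc.
    apply omul_add_lt; [exact He | apply omul_add_lt; assumption].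
Qed.

Lemma omul_ge_1 (x y : ord) : fin 1 <= x -> fin 1 <= y -> fin 1 <= x * y.
Proof. intros Hx Hy; rewrite <- Hx, <- Hy, omul_1_r; reflexivity. Qed.

Lemma omul_2_r (x : ord) : x * fin 2 == x + x.
Proof. rewrite fin_S, omul_add_r, omul_1_r; reflexivity. Qed.

Lemma omul_S_r (x : ord) (n : nat) : x * fin (S n) == x * fin n + x.
Proof. rewrite fin_S, omul_add_r, omul_1_r; reflexivity. Qed.

Lemma fin_mul (m n : nat) : fin m * fin n == fin (m * n)%nat.
Proof.
  induction n as [| n IH].
  - rewrite Nat.mul_0_r; apply omul_0_r.
  - rewrite omul_S_r, IH, fin_add, Nat.mul_succ_r; reflexivity.
Qed.

(** Continuity at [omega]. A bound [x * fin n + c] with [c < x] fits below [n + 1] copies of [x],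
    hence the witness [S n]. *)
Lemma olt_omul_omega (x z : ord) : z < x * omega <-> exists n, z < x * fin n.
Proof.
  split.
  - intros [d [c [[n Hd]%olt_omega [Hc H]]]]%olt_omul; exists (S n).
    apply (ole_lt_trans _ _ _ H); rewrite Hd.
    apply omul_add_lt; [apply olt_osucc; reflexivity | exact Hc].
  - intros [n H]; apply (olt_le_trans _ _ _ H).
    rewrite (olt_le _ _ (fin_lt_omega n)); reflexivity.
Qed.

Lemma fin_mul_omega (n : nat) : (0 < n)%nat -> fin n * omega == omega.
Proof.
  intros Hn; split.
  - apply ole_iff_lt; intros z [m Hz]%olt_omul_omega; rewrite fin_mul in Hz.
    transitivity (fin (n * m)); [exact Hz | apply fin_lt_omega].
  - rewrite <- (omul_1_l omega) at 1; rewrite (fin_le 1 n Hn); reflexivity.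
Qed.

(** Division with remainder. The quotient is the least [d] with [x <= a * d + c] for some [c < a];
    if [x] were below [a * q], unfolding that inequality would produce a smaller such [d]. *)
Lemma omul_div (a b x : ord) :
  x < a * b -> exists q r, q < b /\ r < a /\ x == a * q + r.
Proof.
  intros Hx%olt_omul.
  destruct (least_ord (fun d => exists c, d < b /\ c < a /\ x <= a * d + c) Hx)
    as [q [[c [Hq [Hc Hxc]]] Hmin]].
  destruct (ole_subtract (a * q) x) as [r Hr].
  - destruct (ole_or_lt (a * q) x) as [H | [d [c' [Hd [Hc' H]]]]%olt_omul]; [exact H |].
    exfalso; apply (ole_not_lt q d); [apply Hmin; exists c' | exact Hd].
    split; [transitivity q; assumption | split; assumption].
  - exists q, r; split; [exact Hq | split; [| symmetry; exact Hr]].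
    apply (ole_lt_trans _ c); [| exact Hc].
    apply (oadd_le_cancel_l (a * q)); rewrite Hr; exact Hxc.
Qed.

(** * Powers of omega *)

Lemma omega_pow_ge_1 (y : ord) : fin 1 <= omega ^ y.
Proof.
  induction y as [B g IH].
  (* Excluded middle decides which summand of the supremum exists: one from a child of the exponent,
     or the 1 reserved for exponent zero. *)
  destruct (classic (inhabited B)) as [[b] | Hn].
  - transitivity (omega ^ g b * omega).
    + apply omul_ge_1; [apply IH | apply olt_le, fin_lt_omega].
    + exact (osup_ub _ (fun s : B + (B -> False) =>
        match s with inl b => omega ^ g b * omega | inr _ => fin 1 end) (inl b)).
  - exact (osup_ub _ (fun s : B + (B -> False) =>
        match s with inl b => omega ^ g b * omega | inr _ => fin 1 end)
        (inr (fun b => Hn (inhabits b)))).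
Qed.

(** The summand 1 occurs in the supremum only for exponent zero, but since all powers of [omega] are
    at least 1 the clause [z < fin 1] is sound for every exponent. *)
Lemma olt_omega_pow_elt (y z : ord) :
  z < omega ^ y <-> z < fin 1 \/ exists b, z < omega ^ elt y b * omega.
Proof.
  split.
  - destruct y as [B g]; intros [[b | e] H]%olt_osup; [right; exists b |left]; exact H.
  - intros [H | [b H]]; [exact (olt_le_trans _ _ _ H (omega_pow_ge_1 y)) |].
    destruct y as [B g]; apply olt_osup; exists (inl b); exact H.
Qed.

Lemma omega_pow_mono (y z : ord) : y <= z -> omega ^ y <= omega ^ z.
Proof.
  revert z; induction y as [B g IH]; intros z Hy.
  apply ole_iff_lt; intros w [H | [b H]]%olt_omega_pow_elt; apply olt_omega_pow_elt.
  - left; exact H.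
  - destruct (proj1 (ole_lt_elt _ _) Hy b) as [c Hc]; right; exists c.
    apply (olt_le_trans _ _ _ H); apply omul_mono; [apply IH, Hc | reflexivity].
Qed.

#[export] Instance omega_pow_mono_proper : Proper (ole ==> ole) (opow omega).
Proof. exact omega_pow_mono. Qed.

#[export] Instance omega_pow_proper : Proper (oeq ==> oeq) (opow omega).
Proof. intros y z [H1 H2]; split; apply omega_pow_mono; assumption. Qed.

Lemma olt_omega_pow (y z : ord) :
  z < omega ^ y <-> z < fin 1 \/ exists d, d < y /\ z < omega ^ d * omega.
Proof.
  rewrite olt_omega_pow_elt; split; (intros [H | H]; [left; exact H | right]).
  - destruct H as [b H]; exists (elt y b); split; [apply elt_lt | exact H].
  - destruct H as [d [[b Hb] H]]; exists b; apply (olt_le_trans _ _ _ H).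
    rewrite Hb; reflexivity.
Qed.

Lemma omega_pow_0 : omega ^ fin 0 == fin 1.
Proof.
  split; [| apply omega_pow_ge_1].
  apply ole_iff_lt; intros z [H | [d [[[] _] _]]]%olt_omega_pow; exact H.
Qed.

Lemma omega_pow_mul_omega_le (d y : ord) : d < y -> omega ^ d * omega <= omega ^ y.
Proof.
  intros Hd; apply ole_iff_lt; intros z Hz; apply olt_omega_pow; right.
  exists d; split; assumption.
Qed.

Lemma omega_pow_add (y z : ord) : omega ^ (y + z) == omega ^ y * omega ^ z.
Proof.
  induction z as [z IH] using (well_founded_ind olt_wf); split.
  - apply ole_iff_lt; intros w [H | [d [[Hd | [e [He Hd]]]%olt_oadd H]]]%olt_omega_pow.
    + apply (olt_le_trans _ _ _ H), omul_ge_1; apply omega_pow_ge_1.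
    + apply (olt_le_trans _ _ _ H); rewrite (omega_pow_mul_omega_le _ _ Hd).
      rewrite <- (omul_1_r (omega ^ y)) at 1.
      rewrite <- (omega_pow_ge_1 z); reflexivity.
    + apply (olt_le_trans _ _ _ H).
      rewrite Hd, (IH e He), omul_assoc, (omega_pow_mul_omega_le _ _ He); reflexivity.
  - apply omul_le; intros d c [Hd%olt_fin_1 | [e [He Hd]]]%olt_omega_pow Hc.
    + rewrite Hd, omul_0_r, oadd_0_l; apply (olt_le_trans _ _ _ Hc).
      rewrite <- (ole_oadd_l y z); reflexivity.
    + apply (olt_le_trans _ _ _ (omul_add_lt _ _ _ _ Hd Hc)).
      rewrite <- omul_assoc, <- (IH e He).
      apply omega_pow_mul_omega_le, oadd_lt_r, He.
Qed.

Lemma omega_pow_1 : omega ^ fin 1 == omega.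
Proof.
  split.
  - apply ole_iff_lt; intros z [H | [d [Hd%olt_fin_1 H]]]%olt_omega_pow.
    + exact (olt_le_trans _ _ _ H (olt_le _ _ (fin_lt_omega 1))).
    + rewrite Hd, omega_pow_0, omul_1_l in H; exact H.
  - rewrite <- omega_pow_mul_omega_le; [| apply olt_fin_1; reflexivity].
    rewrite omega_pow_0, omul_1_l; reflexivity.
Qed.

Lemma omega_pow_succ (y : ord) : omega ^ (y + fin 1) == omega ^ y * omega.
Proof. rewrite omega_pow_add, omega_pow_1; reflexivity. Qed.

Lemma omega_pow_lt (y z : ord) : y < z -> omega ^ y < omega ^ z.
Proof.
  intros H; refine (olt_le_trans _ _ _ _ (omega_pow_mul_omega_le _ _ H)).
  rewrite <- (omul_1_r (omega ^ y)) at 1.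
  apply omul_lt_r; [apply omega_pow_ge_1 | apply fin_lt_omega].
Qed.

Lemma omega_pow_lt_cancel (y z : ord) : omega ^ y < omega ^ z -> y < z.
Proof.
  intros H; destruct (ole_or_lt z y) as [Hzy | Hyz]; [| exact Hyz].
  destruct (ole_not_lt _ _ (omega_pow_mono _ _ Hzy) H).
Qed.

(** Provides a power of [omega] strictly above [x], namely [omega ^ (x + fin 1)], so that a least
    one can be taken. *)
Lemma ole_omega_pow (x : ord) : x <= omega ^ x.
Proof.
  induction x as [x IH] using (well_founded_ind olt_wf).
  apply ole_iff_lt; intros z Hz.
  exact (ole_lt_trans _ _ _ (IH z Hz) (omega_pow_lt _ _ Hz)).
Qed.

(** Continuity of the exponential. The point [a] makes the index type nonempty; over an empty one
    the left side would be 1 and the right side 0. *)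
Lemma omega_pow_osup (A : Type) (f : A -> ord) (a : A) :
  omega ^ osup f == osup (fun a => omega ^ f a).
Proof.
  split.
  - apply ole_iff_lt; intros z [H | [d [[b Hd]%olt_osup H]]]%olt_omega_pow.
    + apply olt_osup; exists a; exact (olt_le_trans _ _ _ H (omega_pow_ge_1 _)).
    + apply olt_osup; exists b.
      exact (olt_le_trans _ _ _ H (omega_pow_mul_omega_le _ _ Hd)).
  - apply osup_le; intros b; apply omega_pow_mono, osup_ub.
Qed.

(** Some [d < y] and [n] satisfy [x < omega ^ d * fin n]. With [y = d + 1 + e], factoring out
    [omega ^ d] reduces the claim to the absorption of [fin n] by [omega * omega ^ e]. *)
Lemma omega_pow_absorb (x y : ord) : x < omega ^ y -> x + omega ^ y == omega ^ y.
Proof.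
  intros H; split; [| apply ole_oadd_r].
  destruct (proj1 (olt_omega_pow _ _) H)
    as [Hx%olt_fin_1 | [d [Hd [n Hx]%olt_omul_omega]]].
  - rewrite Hx, oadd_0_l; reflexivity.
  - destruct (ole_subtract (d + fin 1) y) as [e He].
    { rewrite oadd_1_r; apply osucc_le, Hd. }
    rewrite (olt_le _ _ Hx), <- He, !omega_pow_add, omega_pow_1, omul_assoc.
    rewrite <- omul_add_r.
    (* Writing [omega ^ e] as [1 + f] exposes a leading summand [omega], which swallows [fin n]. *)
    destruct (ole_subtract (fin 1) (omega ^ e) (omega_pow_ge_1 e)) as [f Hf].
    rewrite <- Hf, (omul_add_r omega), omul_1_r, <- oadd_assoc.
    rewrite fin_add_omega; reflexivity.
Qed.

(** * Leading monomials *)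

(** The first term of a Cantor normal form, with all later terms collected in one remainder [rho];
    products can then be computed without handling lists. *)
Definition has_lead (x xi : ord) (r : nat) : Prop :=
  (0 < r)%nat /\ exists rho, rho < omega ^ xi /\ x == omega ^ xi * fin r + rho.

#[export] Instance has_lead_proper : Proper (oeq ==> oeq ==> eq ==> iff) has_lead.
Proof.
  intros x x' Hx xi xi' Hxi r r' <-; unfold has_lead.
  setoid_rewrite Hx; setoid_rewrite Hxi; reflexivity.
Qed.

Lemma has_lead_ge (x xi : ord) (r : nat) : has_lead x xi r -> omega ^ xi * fin r <= x.
Proof. intros [_ [rho [_ ->]]]; apply ole_oadd_l. Qed.

Lemma has_lead_ge_pow (x xi : ord) (r : nat) : has_lead x xi r -> omega ^ xi <= x.
Proof.
  intros H; rewrite <- (has_lead_ge _ _ _ H), <- (fin_le 1 r); [| apply H].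
  rewrite omul_1_r; reflexivity.
Qed.

Lemma has_lead_lt (x xi : ord) (r : nat) :
  has_lead x xi r -> x < omega ^ xi * fin (S r).
Proof. intros [_ [rho [Hrho ->]]]; rewrite omul_S_r; apply oadd_lt_r, Hrho. Qed.

Lemma has_lead_lt_pow_succ (x xi : ord) (r : nat) :
  has_lead x xi r -> x < omega ^ (xi + fin 1).
Proof.
  intros H; rewrite omega_pow_succ; apply olt_omul_omega.
  exists (S r); apply has_lead_lt, H.
Qed.

(** The least [z] with [x < omega ^ z] yields some [xi < z] with [x < omega ^ xi * omega]. Dividing
    [x] by [omega ^ xi] gives a finite quotient, the leading coefficient. *)
Lemma has_lead_exists (x : ord) : fin 1 <= x -> exists xi r, has_lead x xi r.
Proof.
  intros Hx.
  assert (H : x < omega ^ (x + fin 1)).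
  { apply (ole_lt_trans _ _ _ (ole_omega_pow x)), omega_pow_lt.
    rewrite oadd_1_r; apply olt_osucc; reflexivity. }
  destruct (least_ord (fun z => x < omega ^ z)
    (ex_intro (fun z => x < omega ^ z) _ H)) as [z [Hz Hmin]].
  destruct (proj1 (olt_omega_pow _ _) Hz) as [Hx' | [xi [Hxi Hlt]]].
  { destruct (ole_not_lt _ _ Hx Hx'). }
  destruct (omul_div _ _ _ Hlt) as [q [rho [[r Hr]%olt_omega [Hrho Heq]]]].
  rewrite Hr in Heq; exists xi, r; split; [| exists rho; split; assumption].
  (* A zero quotient would leave [x] equal to the remainder, below [omega ^ xi], against the
     minimality of [z]. *)
  destruct r as [| r]; [| lia].
  rewrite omul_0_r, oadd_0_l in Heq; rewrite <- Heq in Hrho.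
  destruct (ole_not_lt _ _ (Hmin _ Hrho) Hxi).
Qed.

(** By induction the tail stays below the power of its predecessor, so the sum stays below one more
    copy of the head power. This makes the tail of a normal form a legitimate remainder. *)
Lemma cnf_val_lt (l : list (ord * nat)) (xi : ord) :
  StronglySorted (fun p q => fst q < fst p) l ->
  Forall (fun p => fst p < xi) l -> cnf_val l < omega ^ xi.
Proof.
  revert xi; induction l as [| [eta s] l IH]; intros xi Hs Hl.
  - apply osucc_le, omega_pow_ge_1.
  - apply StronglySorted_inv in Hs; destruct Hs as [Hs Hl'].
    apply Forall_inv in Hl; simpl in *.
    refine (olt_le_trans _ _ _ _ (omega_pow_mul_omega_le _ _ Hl)).
    apply olt_omul_omega; exists (S s); rewrite omul_S_r.
    apply oadd_lt_r, IH; assumption.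
Qed.

Lemma is_cnf_cons (x xi : ord) (r : nat) (l : list (ord * nat)) :
  is_cnf x ((xi, r) :: l) -> has_lead x xi r.
Proof.
  intros [Hs [Hp Hx]]; apply StronglySorted_inv in Hs; destruct Hs as [Hs Hl].
  split; [exact (Forall_inv Hp) |].
  exists (cnf_val l); split; [apply cnf_val_lt; assumption | exact Hx].
Qed.

Lemma is_cnf_exists (x : ord) : exists l, is_cnf x l.
Proof.
  induction x as [x IH] using (well_founded_ind olt_wf).
  destruct (classic (x == fin 0)) as [H0 | H0].
  { exists []; split; [constructor | split; [constructor | exact H0]]. }
  destruct (has_lead_exists x) as [xi [r Hr]]; [apply nonzero_ge_1, H0 |].
  assert (Hxi := has_lead_ge_pow _ _ _ Hr); destruct Hr as [Hr [rho [Hrho Hx]]].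
  destruct (IH rho) as [l Hl]; [exact (olt_le_trans _ _ _ Hrho Hxi) |].
  exists ((xi, r) :: l); split; [| split].
  - constructor; [apply Hl |].
    destruct l as [| [eta s] l]; [constructor |].
    (* The remainder is at least [omega ^ eta] and below [omega ^ xi], which orders the two first
       exponents; transitivity handles the later ones. *)
    assert (Heta : eta < xi).
    { apply omega_pow_lt_cancel; refine (ole_lt_trans _ _ _ _ Hrho).
      exact (has_lead_ge_pow _ _ _ (is_cnf_cons _ _ _ _ Hl)). }
    constructor; [exact Heta |].
    destruct Hl as [Hs _]; apply StronglySorted_inv in Hs; destruct Hs as [_ Hl].
    eapply Forall_impl; [| exact Hl]; intros p Hp; exact (transitivity Hp Heta).
  - constructor; [exact Hr | apply Hl].
  - simpl; rewrite Hx; apply oadd_proper; [reflexivity | apply Hl].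
Qed.

(** Existence of a normal form is what makes the list picked by [epsilon] meet its specification. *)
Lemma cnf_spec (x : ord) : is_cnf x (cnf x).
Proof. exact (epsilon_spec _ _ (is_cnf_exists x)). Qed.

Lemma degree_lead_spec (x : ord) : ~ x == fin 0 ->
  exists r, has_lead x (degree x) r /\ lead_monomial x = omega ^ degree x * fin r.
Proof.
  intros Hx; unfold degree, lead_monomial; assert (H := cnf_spec x).
  destruct (cnf x) as [| [xi r] l]; [destruct (Hx (proj2 (proj2 H))) |].
  exists r; split; [exact (is_cnf_cons _ _ _ _ H) | reflexivity].
Qed.

Lemma lead_monomial_0 (x : ord) : x == fin 0 -> lead_monomial x == fin 0.
Proof.
  intros Hx; unfold lead_monomial; assert (H := cnf_spec x).
  destruct (cnf x) as [| [xi r] l]; [reflexivity |].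
  apply is_cnf_cons, has_lead_ge_pow in H; rewrite <- omega_pow_ge_1, Hx in H.
  destruct (proj2 (nonzero_ge_1 (fin 0)) H (reflexivity _)).
Qed.

Lemma lead_monomial_ge_1 (x : ord) : ~ x == fin 0 -> fin 1 <= lead_monomial x.
Proof.
  intros [r [Hr ->]]%degree_lead_spec; apply omul_ge_1; [apply omega_pow_ge_1 |].
  apply fin_le, Hr.
Qed.

Lemma degree_ge_1 (x : ord) : ~ x < omega -> fin 1 <= degree x.
Proof.
  intros Hx; destruct (ole_or_lt (fin 1) (degree x)) as [H | H%olt_fin_1]; [exact H |].
  exfalso; apply Hx.
  destruct (classic (x == fin 0)) as [H0 | H0]; [rewrite H0; apply fin_lt_omega |].
  destruct (degree_lead_spec x H0) as [r [Hr%has_lead_lt_pow_succ _]].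
  rewrite H, oadd_0_l, omega_pow_1 in Hr; exact Hr.
Qed.

Lemma degree_finite (x : ord) : ~ x == fin 0 -> x < omega -> degree x == fin 0.
Proof.
  intros [r [Hr%has_lead_ge_pow _]]%degree_lead_spec Hx; apply olt_fin_1.
  apply omega_pow_lt_cancel; rewrite omega_pow_1; exact (ole_lt_trans _ _ _ Hr Hx).
Qed.

Lemma ge_2 (x : ord) : ~ x == fin 0 -> ~ x == fin 1 -> fin 2 <= x.
Proof.
  intros H0%nonzero_ge_1 H1.
  destruct (ole_or_lt (fin 2) x) as [H | H%olt_osucc]; [exact H |].
  destruct H1; split; assumption.
Qed.

(** If the leading monomial were 1, then [omega ^ degree x] would be at most 1, the remainder would
    vanish, and [x] would be 1. *)
Lemma lead_monomial_ge_2 (x : ord) :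
  ~ x == fin 0 -> ~ x == fin 1 -> fin 2 <= lead_monomial x.
Proof.
  intros H0 H1; assert (Hm := lead_monomial_ge_1 x H0).
  apply ge_2; [apply nonzero_ge_1, Hm |]; intros Hm1; apply H1.
  destruct (degree_lead_spec x H0) as [r [[Hr [rho [Hrho Hx]]] Hlm]].
  rewrite <- Hlm, Hm1 in Hx.
  assert (Hle : omega ^ degree x <= fin 1).
  { rewrite <- Hm1, Hlm, <- (fin_le 1 r Hr), omul_1_r; reflexivity. }
  rewrite Hle in Hrho; apply olt_fin_1 in Hrho.
  rewrite Hx, Hrho, oadd_0_r; reflexivity.
Qed.

(* The remainder [rho] is absorbed by the copies of [omega ^ xi] to its right. *)
Lemma has_lead_mul_fin (x xi : ord) (r n : nat) :
  has_lead x xi r -> (0 < n)%nat -> has_lead (x * fin n) xi (r * n).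
Proof.
  intros [Hr [rho [Hrho Hx]]] Hn; split; [lia |]; exists rho; split; [exact Hrho |].
  destruct r as [| r]; [lia |]; clear Hr.
  induction Hn as [| n Hn IH].
  - rewrite omul_1_r, Nat.mul_1_r; exact Hx.
  - rewrite omul_S_r, IH, Hx, Nat.mul_succ_r, <- fin_add, omul_add_r, !oadd_assoc.
    apply oadd_proper; [reflexivity |].
    rewrite <- (fin_add 1 r), omul_add_r, omul_1_r, <- !oadd_assoc.
    rewrite omega_pow_absorb by exact Hrho; reflexivity.
Qed.

(** Squeeze [x] between [omega ^ xi] and [omega ^ xi * fin (S r)]: as [eta] is at least 1, the power
    on the right begins with a factor [omega] that absorbs [S r]. *)
Lemma has_lead_mul_omega_pow (x xi eta : ord) (r : nat) :
  has_lead x xi r -> fin 1 <= eta -> x * omega ^ eta == omega ^ (xi + eta).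
Proof.
  intros H Heta; split.
  - rewrite (olt_le _ _ (has_lead_lt _ _ _ H)).
    destruct (ole_subtract _ _ Heta) as [e He].
    rewrite <- He, !omega_pow_add, omega_pow_1, !omul_assoc, <- (omul_assoc (fin (S r))).
    rewrite fin_mul_omega by lia; reflexivity.
  - rewrite omega_pow_add, (has_lead_ge_pow _ _ _ H); reflexivity.
Qed.

(** If [eta] is at least 1, the coefficient [r] is absorbed, leaving coefficient [s] and remainder
    [x * sigma]. If [eta] is 0, then [y] is the integer [s] and the coefficients multiply. *)
Lemma has_lead_mul (x y xi eta : ord) (r s : nat) :
  has_lead x xi r -> has_lead y eta s ->
  exists t, has_lead (x * y) (xi + eta) t /\
    (omega ^ xi * fin r) * (omega ^ eta * fin s) == omega ^ (xi + eta) * fin t.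
Proof.
  intros Hx Hy; assert (Hr := proj1 Hx).
  destruct (ole_or_lt (fin 1) eta) as [Heta | Heta%olt_fin_1].
  - destruct Hy as [Hs [sigma [Hsigma Hy]]]; exists s; split; [split; [exact Hs |] |].
    + exists (x * sigma); rewrite <- (has_lead_mul_omega_pow _ _ _ _ Hx Heta).
      split; [| rewrite Hy, omul_add_r, <- omul_assoc; reflexivity].
      apply omul_lt_r; [| exact Hsigma].
      rewrite <- (has_lead_ge_pow _ _ _ Hx); apply omega_pow_ge_1.
    (* The monomial is its own leading term, with remainder 0, so the same absorption applies to
       it. *)
    + assert (Hm : has_lead (omega ^ xi * fin r) xi r).
      { split; [exact Hr |]; exists (fin 0); rewrite oadd_0_r.
        split; [apply osucc_le, omega_pow_ge_1 | reflexivity]. }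
      rewrite <- (has_lead_mul_omega_pow _ _ _ _ Hm Heta), <- !omul_assoc; reflexivity.
  - exists (r * s)%nat; rewrite Heta in Hy |- *.
    destruct Hy as [Hs [sigma [Hsigma Hy]]].
    rewrite omega_pow_0 in Hsigma, Hy; apply olt_fin_1 in Hsigma.
    rewrite Hsigma, oadd_0_r, omul_1_l in Hy.
    rewrite oadd_0_r, Hy; split; [apply has_lead_mul_fin; assumption |].
    rewrite omega_pow_0, omul_1_l, omul_assoc, fin_mul; reflexivity.
Qed.

(** * Limits of sequences *)

(** If [l' < l], then [l'] bounds the sequence strictly from below eventually, while [osucc l']
    bounds it strictly from above eventually; a common index is contradictory. *)
Lemma is_lim_unique (s : nat -> ord) (l l' : ord) :
  is_lim s l -> is_lim s l' -> l == l'.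
Proof.
  enough (H : forall l l', is_lim s l -> is_lim s l' -> l <= l').
  { split; apply H; assumption. }
  clear l l'; intros l l' Hl Hl'.
  destruct (ole_or_lt l l') as [H | H]; [exact H | exfalso].
  destruct (proj1 Hl l' H) as [N HN].
  destruct (proj2 Hl' (osucc l') (proj2 (olt_osucc _ _) (reflexivity _))) as [M HM].
  apply (ole_not_lt (s (max N M)) l'); [apply olt_osucc, HM | apply HN]; lia.
Qed.

Lemma olim_eq (s : nat -> ord) (l : ord) : is_lim s l -> olim s == l.
Proof.
  intros H; refine (is_lim_unique s _ _ _ H); unfold olim.
  apply epsilon_spec; exists l; exact H.
Qed.

Lemma olim_eventually_const (s : nat -> ord) (c : ord) :
  eventually (fun n => s n == c) -> olim s == c.
Proof.
  intros [N HN]; apply olim_eq.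
  split; intros a Ha; exists N; intros n Hn; rewrite (HN n Hn); exact Ha.
Qed.

Definition nondecreasing (s : nat -> ord) : Prop := forall n, s n <= s (S n).

Lemma nondecreasing_le (s : nat -> ord) (m n : nat) :
  nondecreasing s -> (m <= n)%nat -> s m <= s n.
Proof.
  intros Hs H; induction H as [| n H IH]; [reflexivity |].
  rewrite IH; apply Hs.
Qed.

(** Replaces topological limits by suprema, so that monotone sequences can be compared by
    cofinality. *)
Lemma olim_osup (s : nat -> ord) : nondecreasing s -> olim s == osup s.
Proof.
  intros Hs; apply olim_eq; split.
  - intros a [N HN]%olt_osup; exists N; intros n Hn.
    rewrite <- (nondecreasing_le _ _ _ Hs Hn); exact HN.
  - intros b Hb; exists 0%nat; intros n _; rewrite (osup_ub _ s n); exact Hb.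
Qed.

Lemma osup_le_osup (s t : nat -> ord) :
  (forall n, exists m, s n <= t m) -> osup s <= osup t.
Proof.
  intros H; apply osup_le; intros n; destruct (H n) as [m Hm].
  rewrite Hm; apply osup_ub.
Qed.

Lemma not_eventually (P : nat -> Prop) (N : nat) :
  ~ eventually P -> exists n, (N <= n)%nat /\ ~ P n.
Proof.
  intros H; apply NNPP; intros Hn; apply H; exists N; intros n HN.
  apply NNPP; intros HP; apply Hn; exists n; split; assumption.
Qed.

(** * Infinite sums and products *)

Lemma psum_nondecreasing (a : nat -> ord) : nondecreasing (psum a).
Proof. intros n; apply ole_oadd_l. Qed.

Lemma osum_osup (a : nat -> ord) : osum a == osup (psum a).
Proof. apply olim_osup, psum_nondecreasing. Qed.

Lemma pprod_nondecreasing (a : nat -> ord) :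
  (forall i, ~ a i == fin 0) -> nondecreasing (pprod a).
Proof.
  intros H n; simpl; rewrite <- (proj1 (nonzero_ge_1 _) (H n)), omul_1_r; reflexivity.
Qed.

Lemma oprod_osup (a : nat -> ord) :
  (forall i, ~ a i == fin 0) -> oprod a == osup (pprod a).
Proof. intros H; apply olim_osup, pprod_nondecreasing, H. Qed.

Lemma oprod_0 (a : nat -> ord) (i : nat) : a i == fin 0 -> oprod a == fin 0.
Proof.
  (* [pprod a (S i)] is the first partial product that contains the factor [a i]. *)
  intros H; apply olim_eventually_const; exists (S i); intros n Hn.
  induction Hn as [| n Hn IH]; simpl.
  - rewrite H; apply omul_0_r.
  - rewrite IH; apply omul_0_l.
Qed.

Lemma pprod_omega_pow (b : nat -> ord) (n : nat) :
  pprod (fun i => omega ^ b i) n == omega ^ psum b n.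
Proof.
  induction n as [| n IH]; simpl pprod; simpl psum.
  - symmetry; apply omega_pow_0.
  - rewrite IH, omega_pow_add; reflexivity.
Qed.

Lemma omega_pow_osum (b : nat -> ord) :
  omega ^ osum b == osup (fun n => omega ^ psum b n).
Proof. rewrite osum_osup; apply omega_pow_osup, 0%nat. Qed.

Lemma oprod_omega_pow (b : nat -> ord) :
  oprod (fun i => omega ^ b i) == omega ^ osum b.
Proof.
  rewrite omega_pow_osum, oprod_osup by (intros i; apply nonzero_ge_1, omega_pow_ge_1).
  split; apply osup_le_osup; intros n; exists n; apply pprod_omega_pow.
Qed.

(** The invariant behind all comparisons: one coefficient [t] serves both the product of the factors
    and the product of their leading monomials. *)
Lemma pprod_has_lead (a : nat -> ord) (n : nat) :
  (forall i, ~ a i == fin 0) ->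
  exists t, has_lead (pprod a n) (psum (fun i => degree (a i)) n) t /\
    pprod (fun i => lead_monomial (a i)) n
      == omega ^ psum (fun i => degree (a i)) n * fin t.
Proof.
  intros H0; induction n as [| n [t [Ht Hm]]]; simpl pprod; simpl psum.
  - exists 1%nat; rewrite omega_pow_0, omul_1_r; split; [| reflexivity].
    split; [lia |]; exists (fin 0); rewrite omega_pow_0, omul_1_r, oadd_0_r.
    split; [apply olt_fin_1 |]; reflexivity.
  - destruct (degree_lead_spec (a n) (H0 n)) as [r [Hr Hlm]].
    destruct (has_lead_mul _ _ _ _ _ _ Ht Hr) as [u [Hu Hmu]].
    exists u; split; [exact Hu | rewrite Hm, Hlm; exact Hmu].
Qed.

Lemma omega_pow_psum_le_pprod (a : nat -> ord) (n : nat) :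
  (forall i, ~ a i == fin 0) ->
  omega ^ psum (fun i => degree (a i)) n <= pprod a n.
Proof.
  intros H0; destruct (pprod_has_lead a n H0) as [t [Ht _]].
  exact (has_lead_ge_pow _ _ _ Ht).
Qed.

Lemma pprod_lt_omega_pow_psum (a : nat -> ord) (n : nat) :
  (forall i, ~ a i == fin 0) ->
  pprod a n < omega ^ (psum (fun i => degree (a i)) n + fin 1).
Proof.
  intros H0; destruct (pprod_has_lead a n H0) as [t [Ht _]].
  exact (has_lead_lt_pow_succ _ _ _ Ht).
Qed.

(** A zero factor makes both products 0. Otherwise both sequences of partial products are monotone,
    and each is cofinal in the other. *)
Lemma oprod_lead_monomial (a : nat -> ord) :
  ~ eventually (fun i => a i == fin 1) ->
  oprod a == oprod (fun i => lead_monomial (a i)).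
Proof.
  intros H1; destruct (classic (exists i, a i == fin 0)) as [[i Hi] | Hn].
  { rewrite (oprod_0 a i Hi); symmetry.
    exact (oprod_0 (fun i => lead_monomial (a i)) i (lead_monomial_0 _ Hi)). }
  assert (H0 : forall i, ~ a i == fin 0) by (intros i Hi; apply Hn; exists i; exact Hi).
  assert (Hm : forall i, ~ lead_monomial (a i) == fin 0).
  { intros i; apply nonzero_ge_1, lead_monomial_ge_1, H0. }
  rewrite !oprod_osup by assumption; split; apply osup_le_osup; intros n;
    destruct (pprod_has_lead a n H0) as [t [Ht Hmt]].
  - destruct (not_eventually _ n H1) as [N [HN HaN]]; exists (S N); simpl.
    rewrite <- (lead_monomial_ge_2 _ (H0 N) HaN).
    rewrite <- (nondecreasing_le _ _ _ (pprod_nondecreasing _ Hm) HN), Hmt.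
    rewrite omul_assoc, fin_mul, (olt_le _ _ (has_lead_lt _ _ _ Ht)).
    (* The bound [S t <= t * 2] uses that the coefficient [t] is positive. *)
    rewrite (fin_le (S t) (t * 2)); [reflexivity | destruct Ht; lia].
  - exists n; rewrite Hmt; exact (has_lead_ge _ _ _ Ht).
Qed.

Lemma psum_eventually_0 (b : nat -> ord) (n : nat) :
  (forall i, (n <= i)%nat -> b i == fin 0) ->
  forall k, (n <= k)%nat -> psum b k == psum b n.
Proof.
  intros Hb k Hk; induction Hk as [| k Hk IH]; [reflexivity |].
  simpl; rewrite IH, (Hb k Hk); apply oadd_0_r.
Qed.

(** From index [n] on the degree of the partial products is fixed, which bounds them by the next
    power of [omega]; their coefficients are unbounded, so that power is reached as supremum. *)
Lemma oprod_eventually_finite (a : nat -> ord) (n : nat) :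
  (forall i, ~ a i == fin 0) -> ~ eventually (fun i => a i == fin 1) ->
  (forall i, (n <= i)%nat -> a i < omega) ->
  oprod a == omega ^ (psum (fun i => degree (a i)) n + fin 1).
Proof.
  intros H0 H1 Hfin; rewrite oprod_osup by exact H0.
  set (d := fun i => degree (a i)).
  assert (Hmono := pprod_nondecreasing a H0); split.
  - apply osup_le; intros k.
    (* Moving to the index [max n k] reaches the range where the degree sum is constant. *)
    rewrite (nondecreasing_le _ _ _ Hmono (Nat.le_max_r n k)).
    rewrite (olt_le _ _ (pprod_lt_omega_pow_psum a (max n k) H0)).
    apply omega_pow_mono, oadd_mono; [| reflexivity].
    apply (psum_eventually_0 d n); [| lia].
    intros i Hi; apply degree_finite; auto.
  - (* each factor at least 2 past [n] adds a copy of [omega ^ psum d n] *)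
    assert (Hgrow : forall m, exists k,
      (n <= k)%nat /\ omega ^ psum d n * fin m <= pprod a k).
    { induction m as [| m [k [Hk IH]]].
      - exists n; split; [reflexivity | rewrite omul_0_r; apply ole_0].
      - destruct (not_eventually _ k H1) as [N [HN HaN]].
        exists (S N); split; [lia |]; simpl pprod.
        rewrite <- (ge_2 _ (H0 N) HaN), omul_2_r, omul_S_r; apply oadd_mono.
        (* Of the two copies of [pprod a N], the first contains the [m] copies found so far and the
           second supplies the new one. *)
        + rewrite IH; apply nondecreasing_le; assumption.
        + unfold d; rewrite (omega_pow_psum_le_pprod a n H0).
          apply nondecreasing_le; [exact Hmono | lia]. }
    rewrite omega_pow_succ; apply ole_iff_lt; intros z [m Hz]%olt_omul_omega.
    destruct (Hgrow m) as [k [_ Hk]].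
    rewrite Hk, (osup_ub _ (pprod a) k) in Hz; exact Hz.
Qed.

(** A partial product lies below the power of [omega] one above its degree, and the next infinite
    factor raises the degree sum by at least that 1. *)
Lemma oprod_not_eventually_finite (a : nat -> ord) :
  (forall i, ~ a i == fin 0) -> ~ eventually (fun i => a i < omega) ->
  oprod a == omega ^ osum (fun i => degree (a i)).
Proof.
  intros H0 Hinf; rewrite omega_pow_osum, oprod_osup by exact H0.
  split; apply osup_le_osup; intros n.
  - destruct (not_eventually _ n Hinf) as [N [HN HaN]]; exists (S N).
    rewrite (olt_le _ _ (pprod_lt_omega_pow_psum a n H0)).
    apply omega_pow_mono; simpl psum; apply oadd_mono; [| apply degree_ge_1, HaN].
    apply nondecreasing_le; [apply psum_nondecreasing | exact HN].
  - exists n; apply omega_pow_psum_le_pprod, H0.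
Qed.

Theorem theorem2p8 :
  (forall beta : nat -> ord,
      oprod (fun i => omega ^ beta i) == omega ^ osum beta)
  /\
  (forall alpha : nat -> ord,
      ~ eventually (fun i => alpha i == fin 1) ->
      oprod alpha == oprod (fun i => lead_monomial (alpha i)))
  /\
  (forall alpha : nat -> ord,
      (forall i, ~ alpha i == fin 0) ->
      ~ eventually (fun i => alpha i == fin 1) ->
      let d := fun i => degree (alpha i) in
      let beta := osum d in
      (forall n : nat,
          (forall i : nat, (n <= i)%nat -> alpha i < omega) ->
          oprod alpha == omega ^ (psum d n + fin 1) /\
          omega ^ (psum d n + fin 1) == omega ^ (beta + fin 1))
      /\
      (~ eventually (fun i => alpha i < omega) ->
          oprod alpha == oprod (fun i => omega ^ d i) /\
          oprod (fun i => omega ^ d i) == omega ^ beta)).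
Proof.
  split; [exact oprod_omega_pow | split; [exact oprod_lead_monomial |]].
  intros alpha H0 H1 d beta; split.
  - intros n Hfin; split; [apply oprod_eventually_finite; assumption |].
    (* Finite nonzero factors have degree 0, so the partial sums of degrees are constant from [n]
       on. *)
    assert (Hd : beta == psum d n); [| rewrite Hd; reflexivity].
    apply olim_eventually_const; exists n; apply psum_eventually_0.
    intros i Hi; apply degree_finite; auto.
  - intros Hinf; split; [| apply oprod_omega_pow].
    rewrite oprod_not_eventually_finite by assumption.
    symmetry; exact (oprod_omega_pow d).
Qed.
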